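(* Let $\mathfrak B$ be a Banach space over $\Omega$ and let $A$ be a closed linear operator on $\mathfrak B$ with domain $\mathcal D(A)$. Let $y_0 \in \mathfrak B$ and consider the Cauchy problem $$\frac{dy(z)}{dz} = A y(z), \qquad y(0) = y_0 .$$ Then this problem has a solution in $\mathfrak A_{loc}(\mathfrak B)$ if and only if $y_0 \in E(A)$; moreover, for the solution $y$ one has $\sigma(y_0;A)\, r(y) = p^{-\frac{1}{p-1}}$. Furthermore, the problem is well-posed: the solution is unique, and if a sequence of initial data $y_{n,0} \in E(A)$ converges to $y_0$ in $E(A)$, then the sequence of corresponding solutions $y_n \in \mathfrak A_{loc}(\mathfrak B)$ converges to the solution $y$ in $\mathfrak A_{loc}(\mathfrak B)$.
   Context: $p$ is a prime, $\Omega=\Omega_p$ is the completion of an algebraic closure of the field $\mathbb Q_p$ of $p$-adic numbers, with $p$-adic valuation $|\cdot|_p$. $\mathfrak B$ is a Banach space over $\Omega$ with norm $\|\cdot\|$. A linear operator $A$ is closed if $\mathcal D(A)\ni x_n\to x$ and $Ax_n\to y$ imply $x\in\mathcal D(A)$ and $Ax=y$. For $\alpha>0$, $E_\alpha(A)=\{x\in\bigcap_{n\ge 0}\mathcal D(A^n): \exists c>0\ \forall k\in\mathbb N_0\ \|A^kx\|\le c\alpha^k\}$, a Banach space with norm $\|x\|_\alpha=\sup_{n\ge0}\|A^nx\|/\alpha^n$. $E(A)=\bigcup_{\alpha>0}E_\alpha(A)$ with the inductive limit topology of the spaces $E_\alpha(A)$; convergence $x_n\to x$ in $E(A)$ means there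 is $\alpha>0$ with $x_n\in E_\alpha(A)$ for all large $n$ and $\|x_n-x\|_\alpha\to0$. The type of $x\in E(A)$ is $\sigma(x;A)=\inf\{\alpha>0: x\in E_\alpha(A)\}=\limsup_{n\to\infty}\|A^nx\|^{1/n}$. $\mathfrak A_{loc}(\mathfrak B)$ is the set of vector-functions $y(z)=\sum_{n\ge0}c_nz^n$, $c_n\in\mathfrak B$, $z\in\Omega$, whose convergence radius $r(y)=1/\limsup_{n\to\infty}\|c_n\|^{1/n}$ is positive; $y$ is defined on the open disk $\{z\in\Omega:|z|_p<r(y)\}$. Derivatives are $y^{(k)}(z)=\sum_{n\ge0}(n+1)\cdots(n+k)c_{n+k}z^n$. Convergence $y_n\to y$ in $\mathfrak A_{loc}(\mathfrak B)$ means there is $\delta>0$ with $r(y_n)\ge\delta$ for all $n$ and, for every $\varepsilon\in(0,\delta)$, $\sup_{|z|_p\le\delta-\varepsilon}\|y_n(z)-y(z)\|\to0$. A solution of the Cauchy problem is $y\in\mathfrak A_{loc}(\mathfrak B)$ such that $y(z)\in\mathcal D(A)$ for all $|z|_p<r(y)$ and $y'(z)=Ay(z)$ there, with $y(0)=y_0$.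
   Formalization: When σ(y_0;A) = 0 (for example y_0 = 0) the solution has r(y) = ∞ and the product σ(y_0;A) r(y) is the undefined 0·∞; in that case the formal statement asserts r(y) = ∞ instead of the product equation, which is kept literally when σ(y_0;A) is nonzero. *)

(* Defs.v *)
From HB Require Import structures.
From mathcomp Require Import all_boot all_order all_algebra.
From mathcomp Require Import boolp classical_sets functions reals ereal.
From mathcomp Require Import topology normedtype sequences exp.

Set Implicit Arguments.
Unset Strict Implicit.
Unset Printing Implicit Defensive.

Import Order.TTheory GRing.Theory Num.Theory.
Import numFieldNormedType.Exports.

Local Open Scope classical_set_scope.
Local Open Scope ring_scope.

(* The library norm (normedZmodType) satisfies `|x *+ n| = `|x| *+ n, so it is
   unusable over a p-adic field; hence the dedicated norms absv and vnorm, with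
   convergence and completeness expressed through real sequences. *)
Section NormLimits.
Variables (R : realType) (V : zmodType) (N : V -> R).

Definition ncvg (u : nat -> V) (l : V) : Prop :=
  N (u n - l) @[n --> \oo] --> (0 : R).

Definition ncauchy (u : nat -> V) : Prop :=
  forall e : R, 0 < e ->
    exists n0 : nat, forall m n, (n0 <= m)%N -> (n0 <= n)%N -> N (u m - u n) < e.

Definition ncomplete : Prop := forall u, ncauchy u -> exists l, ncvg u l.

Definition ndense (S : set V) : Prop :=
  forall x (e : R), 0 < e -> exists2 y, S y & N (x - y) < e.

End NormLimits.

HB.mixin Record isValuedField (R : realType) K of GRing.Field K := {
  absv : K -> R;
  absv_ge0 : forall x, 0 <= absv x;
  absv0_eq0 : forall x, absv x = 0 -> x = 0;
  absvM : forall x y, absv (x * y) = absv x * absv y;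
  absv_ultra : forall x y, absv (x + y) <= Num.max (absv x) (absv y)
}.

#[short(type="valuedFieldType")]
HB.structure Definition ValuedField (R : realType) :=
  {K of GRing.Field K & isValuedField R K}.

HB.mixin Record ValuedField_isComplete (R : realType) K of ValuedField R K := {
  absv_complete : ncomplete (@absv R K)
}.

#[short(type="completeValuedFieldType")]
HB.structure Definition CompleteValuedField (R : realType) :=
  {K of ValuedField R K & ValuedField_isComplete R K}.

(* Only the ordinary triangle inequality is required of the norm of a Banach
   space over K, so that ultrametric norms are a special case. *)
HB.mixin Record Lmodule_isBanach (R : realType) (K : valuedFieldType R) V
    of GRing.Lmodule K V := {
  vnorm : V -> R;
  vnorm_ge0 : forall x, 0 <= vnorm x;
  vnorm0_eq0 : forall x, vnorm x = 0 -> x = 0;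
  vnormZ : forall (a : K) x, vnorm (a *: x) = absv a * vnorm x;
  vnormD : forall x y, vnorm (x + y) <= vnorm x + vnorm y;
  vnorm_complete : ncomplete vnorm
}.

#[short(type="banachType")]
HB.structure Definition Banach (R : realType) (K : valuedFieldType R) :=
  {V of GRing.Lmodule K V & Lmodule_isBanach R K V}.

Definition padic_abs (R : realType) (p : nat) (x : rat) : R :=
  if x == 0 then 0
  else p%:R ^ ((logn p `|denq x|%N)%:Z - (logn p `|numq x|%N)%:Z).

(* A completion of F: a complete valued field with an isometric embedding of F
   that has dense range. *)
Definition is_completion (R : realType) (F : fieldType) (v : F -> R)
    (K : completeValuedFieldType R) (i : {rmorphism F -> K}) : Prop :=
  (forall x, absv (i x) = v x) /\ ndense (@absv R K) (range i).

Definition is_algebraic_closure (F L : fieldType) (j : {rmorphism F -> L}) :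
    Prop :=
  GRing.closed_field_axiom L /\ (forall x : L, algebraicOver j x).

(* Omega is the completion of an algebraic closure of Q_p, the absolute value
   being the extension of the normalized one (|p| = 1/p). *)
Definition is_Omega_p (R : realType) (p : nat)
    (Omega : completeValuedFieldType R) : Prop :=
  exists (Qp : completeValuedFieldType R) (Qpbar : valuedFieldType R)
         (i : {rmorphism rat -> Qp}) (j : {rmorphism Qp -> Qpbar})
         (k : {rmorphism Qpbar -> Omega}),
    [/\ is_completion (padic_abs R p) i,
        is_algebraic_closure j,
        (forall x, absv (j x) = absv x) &
        is_completion (@absv R Qpbar) k].

(* The values of the underlying total function outside the domain are
   irrelevant. *)
Record linOp (K : fieldType) (V : lmodType K) := LinOp {
  dom : set V;
  opfun :> V -> V;
  dom0 : dom 0;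
  domP : forall (a : K) x y, dom x -> dom y -> dom (a *: x + y);
  opfunP : forall (a : K) x y, dom x -> dom y ->
    opfun (a *: x + y) = a *: opfun x + opfun y
}.

Section Operators.
Variables (R : realType) (K : valuedFieldType R) (V : banachType K).
Implicit Types (A : linOp V) (x y : V) (a : R).

Definition closed_op A : Prop :=
  forall (u : nat -> V) x y, (forall n, dom A (u n)) ->
    ncvg vnorm u x -> ncvg vnorm (fun n => A (u n)) y -> dom A x /\ A x = y.

Fixpoint dom_iter A (n : nat) : set V :=
  if n is m.+1 then [set x | dom_iter A m x /\ dom A (iter m A x)]
  else setT.

Definition E_a A a : set V :=
  [set x | (forall n, dom_iter A n x) /\
    exists2 c : R, 0 < c & forall k, vnorm (iter k A x) <= c * a ^+ k].

Definition norm_a A a x : \bar R :=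
  ereal_sup (range (fun n : nat => (vnorm (iter n A x) / a ^+ n)%:E)).

Definition E_ A : set V := [set x | exists2 a : R, 0 < a & E_a A a x].

Definition cvg_E A (u : nat -> V) x : Prop :=
  exists a : R, [/\ 0 < a, (\forall n \near \oo, E_a A a (u n)), E_a A a x &
    norm_a A a (u n - x) @[n --> \oo] --> 0%E].

Definition type_of A x : \bar R :=
  ereal_inf [set a%:E | a in [set a : R | 0 < a /\ E_a A a x]].

End Operators.

(* A vector-function z |-> \sum_n c_n z^n is represented by its sequence of
   coefficients c. *)
Section PowerSeries.
Variables (R : realType) (K : valuedFieldType R) (V : banachType K).
Implicit Types (c : nat -> V) (z : K).

(* In \bar R, 0^-1 = +oo and +oo^-1 = 0; the term n = 0 does not affect the
   limit superior. *)
Definition conv_radius c : \bar R :=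
  ((limn_esup (fun n => (vnorm (c n) `^ n%:R^-1)%:E))^-1)%E.

Definition A_loc : set (nat -> V) := [set c | (0 < conv_radius c)%E].

(* The sum of the series (0 by default where it diverges). *)
Definition pow_sum c z : V :=
  xget 0 [set s | ncvg vnorm (series (fun n => z ^+ n *: c n)) s].

Definition derivs (k : nat) c : nat -> V :=
  fun n => c (n + k)%N *+ (\prod_(1 <= i < k.+1) (n + i))%N.

(* For the limit function to be defined on the disks of the definition, its
   radius has to be at least delta as well. *)
Definition cvg_A_loc (c_ : nat -> nat -> V) c : Prop :=
  exists delta : R,
    [/\ 0 < delta, (forall n, (delta%:E <= conv_radius (c_ n))%E),
        (delta%:E <= conv_radius c)%E &
        forall e : R, 0 < e < delta ->
          ereal_sup [set (vnorm (pow_sum (c_ n) z - pow_sum c z))%:E |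
                      z in [set z : K | absv z <= delta - e]]
            @[n --> \oo] --> 0%E].

Definition is_solution (A : linOp V) (y0 : V) c : Prop :=
  [/\ A_loc c,
      (forall z, ((absv z)%:E < conv_radius c)%E ->
         dom A (pow_sum c z) /\ pow_sum (derivs 1 c) z = A (pow_sum c z)) &
      pow_sum c 0 = y0].

End PowerSeries.

(* Main.v *)
(* If y = \sum_n c_n z^n is a solution, then (y(z) - c_0) / z is again mapped by
   A to such a quotient; letting z -> 0 and using that A is closed gives
   A c_n = (n + 1) c_(n+1) by induction on n, hence n! c_n = A^n y_0.
   Conversely these coefficients define a solution, again because A is closed.
   With q = p^(1/(p-1)), Legendre's formula bounds |n!|_p between q^-n and
   p (n + 1) q^-n, so the exponential growth rate of the coefficients is q times
   that of (A^n y_0); this gives the type-radius formula, and the lower bound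
   also gives the uniform estimate behind well-posedness. *)

Require Import Defs.
From HB Require Import structures.
From mathcomp Require Import all_boot all_order all_algebra.
From mathcomp Require Import boolp classical_sets functions reals ereal.
From mathcomp Require Import topology normedtype sequences exp.
From mathcomp Require Import lra.

Set Implicit Arguments.
Unset Strict Implicit.
Unset Printing Implicit Defensive.

Import Order.TTheory GRing.Theory Num.Theory.
Import numFieldNormedType.Exports.

Local Open Scope classical_set_scope.
Local Open Scope ring_scope.

(** * Geometric bounds and the limit superior of n-th roots *)

(* The infimum of the r > 0 with [geobound a r] is limsup_k a_k^(1/k)
   (limn_esup_root_le and limn_esup_root_lt). *)
Definition geobound (R : realType) (a : nat -> R) (r : R) : Prop :=
  exists2 c : R, 0 < c & forall k, a k <= c * r ^+ k.

Lemma geoboundS (R : realType) (b : nat -> R) (a : R) : 0 < a ->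
  geobound b a -> geobound (fun n => b n.+1) a.
Proof.
move=> a0 [C C0 bC]; exists (C * a); first by rewrite mulr_gt0.
by move=> k; rewrite -mulrA -exprS.
Qed.

Lemma geobound_le (R : realType) (b b' : nat -> R) (a : R) :
  (forall k, b k <= b' k) -> geobound b' a -> geobound b a.
Proof. by move=> bb [C C0 bC]; exists C => // k; exact: le_trans (bC k). Qed.

Lemma bernoulli (R : realType) (x : R) n : 0 <= x ->
  1 + n%:R * x <= (1 + x) ^+ n.
Proof.
move=> x0; elim: n => [|n IH]; first by rewrite mul0r addr0 expr0.
have h : (1 + n%:R * x) * (1 + x) <= (1 + x) ^+ n.+1.
  by rewrite exprSr ler_wpM2r// addr_ge0.
apply: le_trans h; rewrite -natr1.
have : 0 <= n%:R * x * x by rewrite !mulr_ge0.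
lra.
Qed.

(** With x = s / r - 1, Bernoulli's inequality gives (s / r)^n >= 1 + n x, which eventually exceeds
    any constant [c]. *)
Lemma geo_dominated (R : realType) (c r s : R) : 0 < r -> r < s ->
  exists N, forall n, (N <= n)%N -> c * r ^+ n <= s ^+ n.
Proof.
move=> r0 rs; pose x := s / r - 1.
have x0 : 0 < x by rewrite subr_gt0 ltr_pdivlMr// mul1r.
have [N hN] : exists N : nat, c / x <= N%:R.
  exists (Num.truncn `|c / x|).+1.
  by apply/ltW/(le_lt_trans (ler_norm _)); rewrite truncnS_gt.
exists N => n Nn.
have -> : s ^+ n = (1 + x) ^+ n * r ^+ n.
  by rewrite -exprMn /x addrC subrK divfK// gt_eqF.
rewrite ler_wpM2r ?exprn_ge0 ?(ltW r0)//.
apply: (le_trans _ (bernoulli n (ltW x0))).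
rewrite -(ler_nat R) in Nn.
have : c <= N%:R * x by rewrite -ler_pdivrMr.
have : N%:R * x <= n%:R * x by rewrite ler_wpM2r// ltW.
lra.
Qed.

(** A linear factor is absorbed by any increase of the rate: with x = s / r - 1, Bernoulli's
    inequality gives k + 1 <= (1 + 1/x) (1 + x)^k. This serves to absorb the factor p (n + 1) in the
    upper bound for |n!|_p. *)
Lemma geobound_le_mulr_poly (R : realType) (a b : nat -> R) (c r s : R) :
  0 < r -> r < s -> (forall k, a k <= c * (k%:R + 1) * b k) ->
  (forall k, 0 <= b k) -> 0 < c ->
  geobound b r -> geobound a s.
Proof.
move=> r0 rs ab b0 c0 [d d0 hb].
pose x := s / r - 1.
have x0 : 0 < x by rewrite subr_gt0 ltr_pdivlMr// mul1r.
exists (c * (1 + x^-1) * d).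
  by rewrite !mulr_gt0// addr_gt0// invr_gt0.
move=> k; apply: (le_trans (ab k)).
have -> : s ^+ k = (1 + x) ^+ k * r ^+ k.
  by rewrite -exprMn /x addrC subrK divfK// gt_eqF.
have h1 : k%:R + 1 <= (1 + x^-1) * (1 + x) ^+ k.
  apply: (@le_trans _ _ ((1 + x^-1) * (1 + k%:R * x))); last first.
    rewrite ler_wpM2l ?bernoulli ?ltW//.
    by rewrite addr_gt0// invr_gt0.
  have : x^-1 * (k%:R * x) = k%:R by rewrite mulrC mulfK// gt_eqF.
  have : 0 < x^-1 by rewrite invr_gt0.
  have : 0 <= k%:R * x by rewrite mulr_ge0// ltW.
  lra.
rewrite -[leLHS]mulrA -!(mulrA c) ler_pM2l//.
by rewrite mulrACA; apply: ler_pM.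
Qed.

Lemma limn_esup_root_ge0 (R : realType) (a : nat -> R) :
  (0 <= limn_esup (fun n => (a n `^ n%:R^-1)%:E))%E.
Proof.
apply: limf_esup_ge0 => [[N _ sub]|n]; first exact: (sub N (leqnn N)).
by rewrite lee_fin powR_ge0.
Qed.

Lemma limn_esup_root_le (R : realType) (a : nat -> R) (r : R) :
  (forall k, 0 <= a k) -> 0 < r -> geobound a r ->
  (limn_esup (fun n => (a n `^ n%:R^-1)%:E) <= r%:E)%E.
Proof.
move=> a0 r0 [c c0 ha]; apply/lee_addgt0Pr => e e0.
have [N hN] : exists N, forall n, (N <= n)%N -> c * r ^+ n <= (r + e) ^+ n.
  by apply: geo_dominated => //; rewrite ltrDl.
(* Starting at [N.+1] excludes n = 0, where [n%:R^-1] is 0 and the root does not undo the power. *)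
have N1 : \oo [set n | (N.+1 <= n)%N] by exists N.+1.
apply: (le_trans (ereal_inf_lbound _)); first by exists [set n | (N.+1 <= n)%N].
apply: ge_ereal_sup => _ [n /= Nn <-]; rewrite lee_fin.
have re0 : 0 <= r + e by rewrite addr_ge0// ltW.
have n0 : n%:R != 0 :> R by rewrite pnatr_eq0; case: n Nn.
have -> : r + e = ((r + e) ^+ n) `^ n%:R^-1.
  by rewrite -powR_mulrn// -powRrM divff// powRr1.
apply: ge0_ler_powR.
- by rewrite invr_ge0.
- exact: a0.
- by rewrite nnegrE exprn_ge0.
- by rewrite (le_trans (ha n))// hN// ltnW.
Qed.

(** The finitely many terms below [N] are paid for by adding the sum of their ratios a_k / r^k to
    the constant. *)
Lemma geobound_near (R : realType) (a : nat -> R) (r : R) N :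
  (forall k, 0 <= a k) -> 0 < r ->
  (forall k, (N <= k)%N -> a k <= r ^+ k) -> geobound a r.
Proof.
move=> a0 r0 h; have s0 : 0 <= \sum_(k < N) a k / r ^+ k.
  by apply: sumr_ge0 => k _; rewrite divr_ge0// exprn_ge0// ltW.
exists (1 + \sum_(k < N) a k / r ^+ k); first by rewrite ltr_wpDr.
move=> k; rewrite -ler_pdivrMr ?exprn_gt0//.
have [kN|Nk] := ltnP k N; last first.
  rewrite (le_trans (y := 1)) ?lerDl//.
  by rewrite ler_pdivrMr ?exprn_gt0// mul1r h.
rewrite (bigD1 (Ordinal kN))//= addrCA lerDl addr_ge0//.
by apply: sumr_ge0 => j _; rewrite divr_ge0// exprn_ge0// ltW.
Qed.

(** A limit superior strictly below r means that the roots on some tail have supremum below r, so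
    a_n <= r^n there; the finite rest only changes the constant. *)
Lemma limn_esup_root_lt (R : realType) (a : nat -> R) (r : R) :
  (forall k, 0 <= a k) ->
  (limn_esup (fun n => (a n `^ n%:R^-1)%:E) < r%:E)%E -> 0 < r /\ geobound a r.
Proof.
move=> a0 lt_r; have r0 : 0 < r.
  by rewrite -lte_fin (le_lt_trans _ lt_r)// limn_esup_root_ge0.
split=> //; have [_ [S [N _ NS] <-] Slt] := ereal_inf_lt lt_r.
apply: (@geobound_near _ _ _ N.+1) => // n Nn.
have : (a n `^ n%:R^-1 < r).
  rewrite -lte_fin; apply: le_lt_trans Slt; apply: ereal_sup_ubound.
  by exists n => //; apply: NS; exact: ltnW.
move=> /ltW; rewrite -(ler_pXn2r (n := n)) ?nnegrE ?powR_ge0 ?(ltW r0) //;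
  last by case: n Nn.
rewrite -[X in X <= _]powR_mulrn ?powR_ge0// -powRrM mulVf ?powRr1//.
by rewrite pnatr_eq0; case: n Nn.
Qed.

(** * Legendre's formula for factorials *)

(** In Legendre's sum of the quotients n / p^i, the term i = 1 is n / p and the others form
    Legendre's sum for n / p. This recursion drives both estimates below. *)
Lemma logn_fact_div p n : prime p ->
  logn p n`! = (n %/ p + logn p (n %/ p)`!)%N.
Proof.
move=> pp; have p1 := prime_gt1 pp.
(* Terms with p^i > k vanish, so a common bound [m] lets the sums for n and n / p run over matching
   ranges. *)
have [m] : exists m, (n < m)%N; first by exists n.+1.
have sumE l k : (k < l)%N ->
    (\sum_(1 <= i < k.+1) k %/ p ^ i = \sum_(1 <= i < l.+1) k %/ p ^ i)%N.
  move=> km; rewrite (@big_cat_nat _ _ _ k.+1 1 l.+1)//=; last exact: ltnW.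
  rewrite [X in (_ + X)%N]big1_seq ?addn0// => i.
  rewrite mem_index_iota => /andP[_ /andP[ki _]].
  by rewrite divn_small// (leq_trans ki)// ltnW// ltn_expl.
move=> nm; rewrite !logn_fact// (sumE m.+1)//; last exact: ltnW.
rewrite (sumE m (n %/ p)%N); last by rewrite (leq_ltn_trans _ nm)// leq_div.
rewrite big_nat_recl// expn1; congr (_ + _)%N.
by apply: eq_bigr => i _; rewrite expnS divnMA.
Qed.

(** With m = n / p, the recursion and the induction hypothesis bound the left side by (p - 1) m + m
    = p m <= n. *)
Lemma logn_fact_le p n : prime p -> (p.-1 * logn p n`! <= n)%N.
Proof.
move=> pp; have p1 := prime_gt1 pp.
elim/ltn_ind: n => -[|n] IH; first by rewrite fact0 logn1 muln0.
rewrite logn_fact_div// mulnDr.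
apply: (@leq_trans (p.-1 * (n.+1 %/ p) + n.+1 %/ p)).
  by rewrite leq_add2l IH// ltn_Pdiv.
by rewrite addnC -mulSn prednK ?prime_gt0// mulnC leq_trunc_div.
Qed.

(* In Legendre's formula, n - (p - 1) v_p(n!) is the sum of the p-adic digits
   of n, and p^(digit sum of n) <= (p n)^(p - 1). *)
Lemma logn_fact_ge p n : prime p -> (0 < n)%N ->
  (p ^ n <= (p ^ logn p n`! * (p * n)) ^ p.-1)%N.
Proof.
move=> pp; have p1 := prime_gt1 pp; have p0 := prime_gt0 pp.
elim/ltn_ind: n => n IH n0.
rewrite logn_fact_div// {1}(divn_eq n p).
have rp : (n %% p <= p.-1)%N by rewrite -ltnS prednK// ltn_mod.
set m := (n %/ p)%N; set r := (n %% p)%N in rp *.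
have [m0|m0] := posnP m.
  rewrite m0 mul0n add0n fact0 logn1 expn0 mul1n.
  apply: (@leq_trans (p ^ p.-1)); first by rewrite leq_exp2l.
  by rewrite leq_exp2r -?subn1 ?subn_gt0// leq_pmulr.
have {}IH := IH m (ltn_Pdiv p1 n0) m0.
(* In the exponent m (p - 1) + m + r, the first block gives a (p - 1)-th power, the induction
   hypothesis bounds p^m, and r <= p - 1 bounds p^r. After taking (p - 1)-th roots only m p <= n
   remains. *)
have -> : (m * p + r = m * p.-1 + m + r)%N.
  by rewrite -{1}(prednK p0) mulnS [(m + _)%N]addnC.
rewrite !expnD (expnM p m).
apply: (@leq_trans
  ((p ^ m) ^ p.-1 * (p ^ logn p m`! * (p * m)) ^ p.-1 * p ^ p.-1)).
  by rewrite leq_mul ?leq_pexp2l// leq_mul.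
rewrite -!expnMn leq_exp2r -?subn1 ?subn_gt0//.
rewrite -mulnA [leqLHS]mulnA [leqRHS]mulnA -!mulnA !leq_pmul2l ?expn_gt0 ?p0//.
by rewrite leq_trunc_div.
Qed.

(** * The p-adic absolute value of rational numbers *)

(** The three isometric embeddings in the construction of Omega are composed; this fixes the
    absolute values of integers, in particular of factorials. *)
Lemma padic_embedding (R : realType) p (Omega : completeValuedFieldType R) :
  is_Omega_p p Omega ->
  exists e : {rmorphism rat -> Omega}, forall x, absv (e x) = padic_abs R p x.
Proof.
move=> [Qp [Qpbar [i [j [k [[hi _] _ hj [hk _]]]]]]].
by exists (k \o (j \o i)) => x /=; rewrite hk hj hi.
Qed.

Lemma padic_abs_nat (R : realType) p n : (0 < n)%N ->
  padic_abs R p n%:R = p%:R ^- logn p n.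
Proof.
move=> n0; rewrite /padic_abs pnatr_eq0 gtn_eqF//.
rewrite -[n%:R]/(n%:~R) denq_int numq_int /= logn1 sub0r.
by rewrite exprnN.
Qed.

(** * Limits and geometrically dominated series in a Banach space *)

Section NormedSpace.
(** The axioms of [absv] also admit the constant function 1, so [absv 0 = 0] has to be assumed here;
    it is later derived from the embedding of the rationals. *)
Variables (R : realType) (K : valuedFieldType R) (absv0 : absv (0 : K) = 0).

Lemma absv1 : absv (1 : K) = 1.
Proof.
have : absv (1 : K) != 0.
  by apply/eqP => /absv0_eq0 /eqP; rewrite oner_eq0.
by move=> /mulfI; apply; rewrite -absvM !mulr1.
Qed.

Lemma absvN1 : absv (-1 : K) = 1.
Proof.
apply/eqP; rewrite -(@eqrXn2 _ 2) ?absv_ge0// expr2 -absvM mulrNN mulr1 absv1.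
by rewrite expr1n.
Qed.

Lemma absvX (x : K) n : absv (x ^+ n) = absv x ^+ n.
Proof.
by elim: n => [|n IH]; rewrite ?expr0 ?absv1// !exprS absvM IH.
Qed.

Lemma absv_gt0 (x : K) : x != 0 -> 0 < absv x.
Proof.
move=> x0; rewrite lt_def absv_ge0 andbT.
by apply: contra_neq x0 => /absv0_eq0.
Qed.

Lemma absvV (x : K) : x != 0 -> absv x^-1 = (absv x)^-1.
Proof.
move=> x0; have ax := lt0r_neq0 (absv_gt0 x0).
by apply: (mulfI ax); rewrite -absvM !divff// absv1.
Qed.

Lemma absv_nat_le1 n : absv (n%:R : K) <= 1.
Proof.
elim: n => [|n IH]; first by rewrite absv0.
rewrite -natr1; apply: le_trans (absv_ultra _ _) _.
by rewrite ge_max IH absv1 lexx.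
Qed.

Variable V : banachType K.
Implicit Types (x y : V) (u v : nat -> V).

Lemma vnorm0 : vnorm (0 : V) = 0.
Proof. by rewrite -(scale0r (0 : V)) vnormZ absv0 mul0r. Qed.

Lemma vnormN x : vnorm (- x) = vnorm x.
Proof. by rewrite -scaleN1r vnormZ absvN1 mul1r. Qed.

Lemma vnorm_sum (I : Type) (r : seq I) (P : pred I) (F : I -> V) :
  vnorm (\sum_(i <- r | P i) F i) <= \sum_(i <- r | P i) vnorm (F i).
Proof.
elim/big_ind2: _ => // [|x1 r1 x2 r2 h1 h2]; first by rewrite vnorm0.
by rewrite (le_trans (vnormD _ _))// lerD.
Qed.

Lemma ncvg_squeeze u x (b : nat -> R) :
  (forall n, vnorm (u n - x) <= b n) -> b n @[n --> \oo] --> (0 : R) ->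
  ncvg vnorm u x.
Proof.
move=> ub b0; apply: (@squeeze_cvgr _ _ _ _ (fun=> 0) b) => //.
  by apply: nearW => n; rewrite vnorm_ge0 ub.
exact: cvg_cst.
Qed.

Lemma ncvg_near u x (e : R) : ncvg vnorm u x -> 0 < e ->
  \forall n \near \oo, vnorm (u n - x) < e.
Proof. by move=> ux e0; exact: cvgr_lt ux e e0. Qed.

Lemma ncvg_vnorm_le u x y (c : R) : ncvg vnorm u x ->
  (forall n, vnorm (u n - y) <= c) -> vnorm (x - y) <= c.
Proof.
move=> ux uc; apply/ler_addgt0Pr => e e0.
have [n un] := filter_ex (ncvg_near ux e0).
rewrite -(subrK (u n) x) -addrA addrC.
apply: le_trans (vnormD _ _) _; apply: lerD => //.
by rewrite -vnormN opprB ltW.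
Qed.

Lemma ncvg_unique u x y : ncvg vnorm u x -> ncvg vnorm u y -> x = y.
Proof.
move=> ux uy; apply/eqP; rewrite -subr_eq0; apply/eqP/vnorm0_eq0.
apply/le_anti/andP; split; last exact: vnorm_ge0.
apply/ler_addgt0Pr => e e0; rewrite add0r.
have e20 : 0 < e / 2 by rewrite divr_gt0.
have [n [un un']] := filter_ex (filterI (ncvg_near ux e20) (ncvg_near uy e20)).
rewrite -(subrK (u n) x) -addrA.
apply: le_trans (vnormD _ _) _; rewrite -vnormN opprB.
by rewrite (splitr e) lerD// ltW.
Qed.

Lemma ncvgZ (a : K) u x : ncvg vnorm u x ->
  ncvg vnorm (fun n => a *: u n) (a *: x).
Proof.
move=> ux; apply: (@ncvg_squeeze _ _ (fun n => absv a * vnorm (u n - x))).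
  by move=> n; rewrite -scalerBr vnormZ.
by rewrite -(mulr0 (absv a)); apply: cvgM ux; exact: cvg_cst.
Qed.

Lemma ncvgD u v x y : ncvg vnorm u x -> ncvg vnorm v y ->
  ncvg vnorm (fun n => u n + v n) (x + y).
Proof.
move=> ux vy.
apply: (@ncvg_squeeze _ _ (fun n => vnorm (u n - x) + vnorm (v n - y))).
  by move=> n; rewrite opprD addrACA vnormD.
by rewrite -(addr0 0); exact: cvgD.
Qed.

Lemma ncvg_cst x : ncvg vnorm (fun=> x) x.
Proof. by rewrite /ncvg subrr vnorm0; exact: cvg_cst. Qed.

Lemma ncvgS u x : ncvg vnorm (fun n => u n.+1) x -> ncvg vnorm u x.
Proof.
by rewrite /ncvg => h; rewrite -(cvg_shiftS (fun n => vnorm (u n - x))).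
Qed.

Lemma geo_sum_le (c r : R) n m : 0 <= c -> 0 <= r -> r < 1 ->
  \sum_(n <= k < m) c * r ^+ k <= c * r ^+ n / (1 - r).
Proof.
move=> c0 r0 r1; rewrite ler_pdivlMr ?subr_gt0//.
have [nm|mn] := leqP n m; last first.
  by rewrite big_geq 1?ltnW// mul0r mulr_ge0// exprn_ge0.
rewrite -mulr_sumr -mulrA ler_wpM2l// mulrBr mulr1 mulr_suml.
under [X in _ - X]eq_bigr do rewrite -exprSr.
by rewrite -opprB -sumrB telescope_sumr// opprB gerBl exprn_ge0.
Qed.

Lemma vnorm_geo_sum_le (t : nat -> V) (c r : R) n m :
  (forall k, vnorm (t k) <= c * r ^+ k) -> 0 <= c -> 0 <= r -> r < 1 ->
  vnorm (\sum_(n <= k < m) t k) <= c * r ^+ n / (1 - r).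
Proof.
move=> tc c0 r0 r1; apply: le_trans (vnorm_sum _ _ _) _.
by apply: le_trans (geo_sum_le n m c0 r0 r1); exact: ler_sum.
Qed.

(** The blocks of the series from n on have norm at most c r^n / (1 - r), which tends to 0, so the
    partial sums are Cauchy. *)
Lemma geo_series_cvg (t : nat -> V) (c r : R) :
  (forall k, vnorm (t k) <= c * r ^+ k) -> 0 <= c -> 0 <= r -> r < 1 ->
  exists s, ncvg vnorm (series t) s.
Proof.
move=> tc c0 r0 r1; apply: vnorm_complete => e e0.
have lim0 : c * r ^+ n / (1 - r) @[n --> \oo] --> (0 : R).
  rewrite -(mul0r (1 - r)^-1) -(mulr0 c).
  by apply: cvgMl; apply: cvgMr; apply: cvg_expr; rewrite ger0_norm.
have [N _ hN] := cvgr_lt _ lim0 e e0.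
exists N => m n; wlog nm : m n / (n <= m)%N.
  move=> H Nm Nn; have [nm|/ltnW mn] := leqP n m; first exact: H.
  by rewrite -vnormN opprB; exact: H.
move=> Nm Nn; apply: le_lt_trans (hN n Nn).
rewrite !seriesEnat/= (@big_cat_nat _ _ _ n 0 m)//= addrAC subrr add0r.
exact: vnorm_geo_sum_le.
Qed.

Lemma geo_series_le (t : nat -> V) (c r : R) s :
  (forall k, vnorm (t k) <= c * r ^+ k) -> 0 <= c -> 0 <= r -> r < 1 ->
  ncvg vnorm (series t) s -> vnorm s <= c / (1 - r).
Proof.
move=> tc c0 r0 r1 ts; rewrite -[s]subr0; apply: ncvg_vnorm_le ts _ => n.
rewrite subr0 seriesEnat/=; have := vnorm_geo_sum_le 0 n tc c0 r0 r1.
by rewrite expr0 mulr1.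
Qed.

End NormedSpace.

(** * Power series and their radius of convergence *)

Section PowerSeriesTheory.
Variables (R : realType) (K : valuedFieldType R) (absv0 : absv (0 : K) = 0).
Variable V : banachType K.
Implicit Types (c d : nat -> V) (z : K).

Lemma conv_radius_ge c (a : R) : 0 < a -> geobound (vnorm \o c) a ->
  (a^-1%:E <= conv_radius c)%E.
Proof.
move=> a0 ca; rewrite /conv_radius.
have := limn_esup_root_le (fun k => vnorm_ge0 (c k)) a0 ca.
rewrite inve_pge ?inE ?limn_esup_root_ge0 ?lee_fin ?invr_ge0 ?(ltW a0)//.
by rewrite inver invr_eq0 gt_eqF// invrK.
Qed.

(** Extracts from a strict inequality of radii a geometric rate with room to spare, so that the
    series at any |z| <= r is dominated by a convergent geometric one. *)
Lemma lt_conv_radius c (r : R) : 0 <= r -> (r%:E < conv_radius c)%E ->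
  exists2 a : R, 0 < a /\ r * a < 1 & geobound (vnorm \o c) a.
Proof.
rewrite /conv_radius => r0.
have cn0 k : 0 <= vnorm (c k) by exact: vnorm_ge0.
have := limn_esup_root_ge0 (vnorm \o c).
have := fun r => @limn_esup_root_lt _ (vnorm \o c) r cn0.
(* An infinite limit superior means radius 0, which cannot exceed [r]. *)
set L := limn_esup _; case: L => [l| |] // Llt; last first.
  by move=> _; rewrite invey lte_fin ltNge r0.
rewrite lee_fin => l0 rl.
have {}rl : r * l < 1.
  move: rl; rewrite inver; case: eqP => [->|/eqP ln0 ]; first by rewrite mulr0.
  by rewrite lte_fin -[l^-1]mul1r ltr_pdivlMr// lt_def ln0.
(* The rate will be l + h; here r h < h (r + 1) = (1 - r l) / 2 keeps r (l + h) below 1. Dividing by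
   r + 1 also covers r = 0. *)
pose h := (1 - r * l) / 2 / (r + 1).
have r10 : 0 < r + 1 by rewrite ltr_wpDl.
have h0 : 0 < h by rewrite !divr_gt0// subr_gt0.
have hE : h * (r + 1) = (1 - r * l) / 2 by rewrite /h divfK// gt_eqF.
have [|a0 ga] := Llt (l + h); first by rewrite lte_fin ltrDl.
exists (l + h) => //; split=> //; rewrite mulrDr.
by move: hE; rewrite mulrDr mulr1 (mulrC h) => hE; lra.
Qed.

Lemma vnorm_pow_term c (C a : R) z : (forall k, vnorm (c k) <= C * a ^+ k) ->
  forall k, vnorm (z ^+ k *: c k) <= C * (absv z * a) ^+ k.
Proof.
move=> cC k; rewrite vnormZ absvX// exprMn mulrCA.
by rewrite ler_wpM2l// exprn_ge0// absv_ge0.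
Qed.

Lemma pow_sumE c z s : ncvg vnorm (series (fun n => z ^+ n *: c n)) s ->
  pow_sum c z = s.
Proof.
move=> cs; rewrite /pow_sum; case: xgetP => [s' _ cs'|/(_ s)//].
exact: (ncvg_unique cs' cs).
Qed.

Lemma pow_sum_cvg c (a : R) z : 0 < a -> geobound (vnorm \o c) a ->
  absv z * a < 1 -> ncvg vnorm (series (fun n => z ^+ n *: c n)) (pow_sum c z).
Proof.
move=> a0 [C C0 cC] za.
have za0 : 0 <= absv z * a by rewrite mulr_ge0 ?absv_ge0 ?(ltW a0).
have [s cs] := geo_series_cvg absv0 (vnorm_pow_term z cC) (ltW C0) za0 za.
by rewrite (pow_sumE cs).
Qed.

Lemma pow_sum_le c (C a : R) z : 0 <= C -> 0 < a ->
  (forall k, vnorm (c k) <= C * a ^+ k) ->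
  absv z * a < 1 -> vnorm (pow_sum c z) <= C / (1 - absv z * a).
Proof.
move=> C0 a0 cC za.
have za0 : 0 <= absv z * a by rewrite mulr_ge0 ?absv_ge0 ?(ltW a0).
have [s cs] := geo_series_cvg absv0 (vnorm_pow_term z cC) C0 za0 za.
rewrite (pow_sumE cs).
exact: (geo_series_le absv0 (vnorm_pow_term z cC)).
Qed.

Lemma pow_sumB c d (a : R) z : 0 < a -> geobound (vnorm \o c) a ->
  geobound (vnorm \o d) a -> absv z * a < 1 ->
  pow_sum (fun n => c n - d n) z = pow_sum c z - pow_sum d z.
Proof.
move=> a0 ca da za; apply: pow_sumE.
have := ncvgD (pow_sum_cvg a0 ca za)
  (ncvgZ (-1) (pow_sum_cvg a0 da za)).
rewrite scaleN1r; congr (ncvg _ _ _); apply/funext => n.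
rewrite !seriesEnat/= scaleN1r -sumrB.
by apply: eq_bigr => i _; rewrite scalerBr.
Qed.

Lemma derivs1E c n : derivs 1 c n = n.+1%:R *: c n.+1.
Proof. by rewrite /derivs big_nat1 addn1 scaler_nat. Qed.

(** The factor n + 1 has absolute value at most 1, so differentiation does not raise the growth
    rate. *)
Lemma geobound_derivs c (a : R) : 0 < a -> geobound (vnorm \o c) a ->
  geobound (vnorm \o derivs 1 c) a.
Proof.
move=> a0 /(geoboundS a0); apply: geobound_le => k /=.
by rewrite derivs1E vnormZ ler_piMl ?vnorm_ge0// absv_nat_le1.
Qed.

(** This holds for every [c]: at z = 0 all partial sums with at least one term equal c_0. *)
Lemma pow_sum0 c : pow_sum c 0 = c 0%N.
Proof.
apply: pow_sumE; apply/ncvgS; apply: (ncvg_squeeze (b := fun=> 0)).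
  move=> n; rewrite seriesEnat/= big_nat_recl//= expr0 scale1r.
  rewrite big1 ?addr0 ?subrr ?vnorm0// => i _.
  by rewrite exprS mul0r scale0r.
exact: cvg_cst.
Qed.

Lemma pow_sumS c (a : R) z : 0 < a -> geobound (vnorm \o c) a ->
  absv z * a < 1 -> pow_sum c z = c 0%N + z *: pow_sum (fun n => c n.+1) z.
Proof.
move=> a0 ca za; apply: pow_sumE; apply/ncvgS.
have := ncvgD (ncvg_cst absv0 (c 0%N))
  (ncvgZ z (pow_sum_cvg a0 (geoboundS a0 ca) za)).
congr (ncvg _ _ _); apply/funext => n.
rewrite !seriesEnat/= big_nat_recl//= expr0 scale1r scaler_sumr.
by congr (_ + _); apply: eq_bigr => i _; rewrite scalerA exprS.
Qed.

(** The difference from c_0 is [u n] times the shifted series, and the latter is bounded by 2 C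
    because |u_n| a <= 1/2. *)
Lemma pow_sum_cvg0 c (a : R) (u : nat -> K) : 0 < a ->
  geobound (vnorm \o c) a -> (forall n, absv (u n) * a <= 2^-1) ->
  absv (u n) @[n --> \oo] --> (0 : R) ->
  ncvg vnorm (fun n => pow_sum c (u n)) (c 0%N).
Proof.
move=> a0 ca ua u0; have [C C0 cC] := geoboundS a0 ca.
apply: (ncvg_squeeze (b := fun n => absv (u n) * (C * 2))) => [n|].
  have h : 2^-1 < 1 :> R by lra.
  rewrite (pow_sumS a0 ca) ?(le_lt_trans (ua n))// addrC addKr vnormZ.
  rewrite ler_wpM2l ?absv_ge0//.
  apply: le_trans (pow_sum_le (ltW C0) a0 cC _) _.
    exact: le_lt_trans (ua n) h.
  rewrite ler_wpM2l ?(ltW C0)// -[leRHS]invrK lef_pV2 ?posrE//.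
    by have := ua n; lra.
  by have := ua n; lra.
by rewrite -(mul0r (C * 2)); exact: cvgMl.
Qed.

End PowerSeriesTheory.

(** * Linear operators with a domain, and their iterates *)

Section LinearOperators.
Variables (K : fieldType) (V : lmodType K) (A : linOp V).
Implicit Types x y : V.

Lemma opfun0 : A 0 = 0.
Proof.
have := opfunP 1 (dom0 A) (dom0 A); rewrite !scale1r addr0.
by move=> /eqP; rewrite -subr_eq0 opprD addrA subrr sub0r oppr_eq0 => /eqP.
Qed.

Lemma domZ (a : K) x : dom A x -> dom A (a *: x).
Proof. by move=> dx; rewrite -[_ *: _]addr0; exact: domP dx (dom0 A). Qed.

Lemma opfunZ (a : K) x : dom A x -> A (a *: x) = a *: A x.
Proof.
move=> dx; rewrite -[a *: x]addr0 (opfunP a dx (dom0 A)).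
by rewrite opfun0 addr0.
Qed.

Lemma domB x y : dom A x -> dom A y -> dom A (x - y).
Proof. by move=> dx dy; rewrite addrC -scaleN1r; exact: domP. Qed.

Lemma opfunB x y : dom A x -> dom A y -> A (x - y) = A x - A y.
Proof.
by move=> dx dy; rewrite addrC -scaleN1r opfunP// scaleN1r addrC.
Qed.

Lemma dom_comb (a : nat -> K) (c : nat -> V) n : (forall k, dom A (c k)) ->
  dom A (\sum_(0 <= k < n) a k *: c k) /\
  A (\sum_(0 <= k < n) a k *: c k) = \sum_(0 <= k < n) a k *: A (c k).
Proof.
move=> dc; elim: n => [|n [dn An]]; first
  by rewrite !big_geq// opfun0; split => //; exact: dom0.
rewrite !big_nat_recr//= ![\sum_(_ <= _ < _) _ + _]addrC.
by split; [exact: domP | rewrite opfunP// An].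
Qed.

End LinearOperators.

Section OperatorPowers.
Variables (R : realType) (K : valuedFieldType R) (V : banachType K).
Variable A : linOp V.
Implicit Types x y : V.

Lemma dom_iterB n x y : dom_iter A n x -> dom_iter A n y ->
  dom_iter A n (x - y) /\ iter n A (x - y) = iter n A x - iter n A y.
Proof.
elim: n => [//|n IH] /= [/IH {}IH dx] [/IH {IH} [dxy xy] dy].
by rewrite xy; split; [split => //; exact: domB | exact: opfunB].
Qed.

Lemma iter_fact (c : nat -> V) :
  (forall n, dom A (c n) /\ A (c n) = derivs 1 c n) ->
  forall n, dom_iter A n (c 0%N) /\ iter n A (c 0%N) = n`!%:R *: c n.
Proof.
move=> cA; elim=> [|n [dn En]]; first by rewrite scale1r.
have [dcn Acn] := cA n; rewrite /= En; split; first by split=> //; exact: domZ.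
by rewrite opfunZ// Acn derivs1E scalerA -natrM factS mulnC.
Qed.

Lemma norm_a_ge (a : R) x n : 0 < a ->
  ((vnorm (iter n A x) / a ^+ n)%:E <= norm_a A a x)%E.
Proof. by move=> a0; apply: ereal_sup_ubound; exists n. Qed.

End OperatorPowers.

(** * From the differential equation to a recurrence for the coefficients *)

Section CauchyProblem.
Variables (R : realType) (K : valuedFieldType R) (absv0 : absv (0 : K) = 0).
(** The powers of [w] supply nonzero points tending to 0; [w] is later taken to be p. *)
Variables (w : K) (w0 : w != 0) (w1 : absv w < 1).
Variables (V : banachType K) (A : linOp V) (A_closed : closed_op A).
Implicit Types (c d : nat -> V) (y : V).

(** Along nonzero points u_n -> 0 the sums c(u_n) tend to c_0 and their images d(u_n) tend to d_0,
    so closedness of A applies. *)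
Lemma intertwined_coef0 c d (a : R) : 0 < a ->
  geobound (vnorm \o c) a -> geobound (vnorm \o d) a ->
  (forall z, z != 0 -> absv z * a <= 2^-1 ->
     dom A (pow_sum c z) /\ A (pow_sum c z) = pow_sum d z) ->
  dom A (c 0%N) /\ A (c 0%N) = d 0%N.
Proof.
move=> a0 ca da cd.
have lim0 : absv w ^+ n @[n --> \oo] --> (0 : R).
  by apply: cvg_expr; rewrite ger0_norm ?absv_ge0.
have a20 : 0 < 2^-1 / a by rewrite divr_gt0.
have [N _ hN] := cvgr_lt _ lim0 _ a20.
(* The shift by [N] puts every point in the disk |z| a <= 1/2. *)
pose u n := w ^+ (n + N).
have ua n : absv (u n) * a <= 2^-1.
  by rewrite -ler_pdivlMr// absvX ltW//; apply: hN => /=; rewrite leq_addl.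
have u0 : absv (u n) @[n --> \oo] --> (0 : R).
  have -> : (fun n => absv (u n)) = (fun n => absv w ^+ (n + N)).
    by apply/funext => n; rewrite absvX.
  by move: lim0; rewrite -(cvg_shiftn N).
have cdu n : dom A (pow_sum c (u n)) /\ A (pow_sum c (u n)) = pow_sum d (u n).
  by apply: cd => //; rewrite expf_neq0.
apply: (A_closed (u := fun n => pow_sum c (u n))).
- by move=> n; have [] := cdu n.
- exact: (pow_sum_cvg0 absv0 a0 ca ua u0).
- under eq_fun do rewrite (cdu _).2.
  exact: (pow_sum_cvg0 absv0 a0 da ua u0).
Qed.

(* The quotient (c(z) - c_0) / z has the shifted coefficients, and A maps it to
   (d(z) - d_0) / z. *)
Lemma intertwined_coef c d (a : R) : 0 < a ->
  geobound (vnorm \o c) a -> geobound (vnorm \o d) a ->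
  (forall z, z != 0 -> absv z * a <= 2^-1 ->
     dom A (pow_sum c z) /\ A (pow_sum c z) = pow_sum d z) ->
  forall n, dom A (c n) /\ A (c n) = d n.
Proof.
move=> a0 ca da cd n; elim: n c d ca da cd => [|n IH] c d ca da cd.
  exact: intertwined_coef0 cd.
have [dc0 Ac0] := intertwined_coef0 a0 ca da cd.
apply: (IH (fun k => c k.+1) (fun k => d k.+1)).
- exact: (@geoboundS _ (vnorm \o c)).
- exact: (@geoboundS _ (vnorm \o d)).
move=> z z0 za; have [dz Az] := cd z z0 za.
have za1 : absv z * a < 1 by apply: le_lt_trans za _; lra.
have shift b : geobound (vnorm \o b) a ->
    pow_sum (fun k => b k.+1) z = z^-1 *: (pow_sum b z - b 0%N).
  move=> ba; rewrite (pow_sumS absv0 a0 ba za1) addrC addKr scalerA.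
  by rewrite mulVf// scale1r.
rewrite !shift// opfunZ ?opfunB ?Az ?Ac0//; last exact: domB.
by split => //; apply: domZ; exact: domB.
Qed.

Lemma solution_coefP x c : is_solution A x c <->
  [/\ A_loc c, c 0%N = x & forall n, dom A (c n) /\ A (c n) = derivs 1 c n].
Proof.
rewrite /is_solution pow_sum0//; split=> [[cl cA cx]|[cl cx cA]]; split=> //.
(* A positive radius provides a rate [a]; the equation on the disk |z| a <= 1/2 already determines
   all coefficients. *)
- have [a [a0 _] ca] := lt_conv_radius (lexx 0) cl.
  apply: (intertwined_coef a0 ca (geobound_derivs absv0 a0 ca)) => z z0 za.
  have [|dz Ez] := cA z; last by split.
  apply: lt_le_trans (conv_radius_ge a0 ca).
  rewrite lte_fin -[a^-1]mul1r ltr_pdivlMr//; apply: le_lt_trans za _; lra.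
- move=> z /(lt_conv_radius (absv_ge0 z)) [a [a0 za] ca].
  have da := geobound_derivs absv0 a0 ca.
  have dc k : dom A (c k) by have [] := cA k.
  have pc := dom_comb (fun k => z ^+ k) _ dc.
  suff: dom A (pow_sum c z) /\ A (pow_sum c z) = pow_sum (derivs 1 c) z.
    by case.
  (* The partial sums lie in the domain and A maps them to the partial sums of the derived series;
     both converge, so A may be applied termwise. *)
  apply: (A_closed (u := series (fun k => z ^+ k *: c k))).
  + by move=> n; have [] := pc n.
  + exact: pow_sum_cvg ca za.
  + have := pow_sum_cvg absv0 a0 da za; congr (ncvg _ _ _); apply/funext => n.
    rewrite !seriesEnat/= (pc n).2; apply: eq_bigr => k _.
    by rewrite (cA k).2.
Qed.

End CauchyProblem.

(** * Size of factorials and growth rates of coefficients *)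

Section PadicCauchy.
Variables (R : realType) (p : nat) (p_prime : prime p).
Variables (K : valuedFieldType R) (emb : {rmorphism rat -> K}).
Hypothesis absv_emb : forall x, absv (emb x) = padic_abs R p x.
Variables (V : banachType K) (A : linOp V) (A_closed : closed_op A).
Implicit Types (c : nat -> V) (x : V).

Let q : R := p%:R `^ (p.-1)%:R^-1.

Let p_gt0 : 0 < p%:R :> R.
Proof. by rewrite ltr0n prime_gt0. Qed.

Let p1_gt0 : (0 < p.-1)%N.
Proof. by rewrite -subn1 subn_gt0 prime_gt1. Qed.

Let q_gt0 : 0 < q.
Proof. exact: powR_gt0. Qed.

Let q_exp : q ^+ p.-1 = p%:R.
Proof.
by rewrite -powR_mulrn ?powR_ge0// -powRrM mulVf ?powRr1 ?ltW// pnatr_eq0 -lt0n.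
Qed.

Let absv0 : absv (0 : K) = 0.
Proof. by rewrite -(rmorph0 emb) absv_emb /padic_abs eqxx. Qed.

Let absv_nat n : (0 < n)%N -> absv (n%:R : K) = p%:R ^- logn p n.
Proof. by move=> n0; rewrite -(rmorph_nat emb) absv_emb padic_abs_nat. Qed.

Let natr_neq0 n : (0 < n)%N -> n%:R != 0 :> K.
Proof.
move=> n0; apply/eqP => nE; have := absv_nat n0; rewrite nE absv0 => /esym/eqP.
by rewrite invr_eq0 expf_eq0 (gt_eqF p_gt0) andbF.
Qed.

Let fact_neq0 n : n`!%:R != 0 :> K.
Proof. exact/natr_neq0/fact_gt0. Qed.

(** Raising to the power p - 1 turns q^n into p^n and leaves an inequality between exponents of
    p. *)
Lemma absv_fact_ge n : q ^- n <= absv (n`!%:R : K).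
Proof.
rewrite absv_nat ?fact_gt0// lef_pV2 ?posrE ?exprn_gt0//.
rewrite -(ler_pXn2r p1_gt0) ?nnegrE ?exprn_ge0 ?(ltW p_gt0) ?(ltW q_gt0)//.
rewrite [leRHS]exprAC q_exp -exprM ler_eXn2l ?ltr1n ?prime_gt1//.
by rewrite mulnC logn_fact_le.
Qed.

Lemma absv_fact_le n : absv (n`!%:R : K) <= p%:R * (n%:R + 1) * q ^- n.
Proof.
rewrite absv_nat ?fact_gt0// ler_pdivlMr ?exprn_gt0// mulrC.
rewrite ler_pdivrMr ?exprn_gt0//.
(* [logn_fact_ge] gives the factor p n only for n > 0; the factor n + 1 in the statement covers n =
   0 as well. *)
case: n => [|n].
  by rewrite expr0 add0r mulr1 fact0 logn1 mulr1 ler1n prime_gt0.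
apply: (@le_trans _ _ ((p ^ logn p n.+1`! * (p * n.+1))%N%:R)).
  rewrite -(ler_pXn2r p1_gt0) ?nnegrE ?exprn_ge0 ?(ltW p_gt0) ?(ltW q_gt0)//.
  by rewrite exprAC q_exp -!natrX ler_nat logn_fact_ge.
rewrite natrM natrX mulrC natrM ler_wpM2r ?exprn_ge0 ?(ltW p_gt0)//.
rewrite ler_wpM2l ?(ltW p_gt0)//.
by rewrite lerDl.
Qed.

Let solutionP x c : is_solution A x c <->
  [/\ A_loc c, c 0%N = x & forall n, dom A (c n) /\ A (c n) = derivs 1 c n].
Proof.
apply: (@solution_coefP _ _ absv0 p%:R) => //.
  by rewrite natr_neq0 ?prime_gt0.
rewrite absv_nat ?prime_gt0// logn_prime// eqxx expr1.
by rewrite invf_lt1 ?ltr1n ?prime_gt1.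
Qed.

Lemma solution_iter x c : is_solution A x c ->
  forall n, [/\ dom_iter A n x, iter n A x = n`!%:R *: c n &
    c n = n`!%:R^-1 *: iter n A x].
Proof.
move=> /solutionP[_ <- /iter_fact cA] n; have [dn En] := cA n; split=> //.
by rewrite En scalerA mulVf// scale1r.
Qed.

(** Since 1 / |n!|_p <= q^n, the rate is multiplied by exactly q, with the same constant. *)
Lemma geobound_coef c x (a : R) : (forall n, c n = n`!%:R^-1 *: iter n A x) ->
  geobound (fun n => vnorm (iter n A x)) a -> geobound (vnorm \o c) (q * a).
Proof.
move=> cE [C C0 xC]; exists C => // n /=.
rewrite cE vnormZ absvV// exprMn mulrCA.
apply: ler_pM; rewrite ?vnorm_ge0 ?invr_ge0 ?absv_ge0//.
by rewrite -[leRHS]invrK lef_pV2 ?posrE ?invr_gt0 ?exprn_gt0 ?absv_gt0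
    ?absv_fact_ge.
Qed.

(** The converse direction loses the factor p (n + 1), hence the passage from [a] to a larger
    [b]. *)
Lemma geobound_iter c x (a b : R) : (forall n, iter n A x = n`!%:R *: c n) ->
  0 < a -> a < b -> geobound (vnorm \o c) a ->
  geobound (fun n => vnorm (iter n A x)) (b / q).
Proof.
move=> cE a0 ab [C C0 cC].
apply: (@geobound_le_mulr_poly _ _
  (fun n => q ^- n * vnorm (c n)) p%:R (a / q)).
- by rewrite divr_gt0.
- by rewrite ltr_pM2r ?invr_gt0.
- move=> n; rewrite cE vnormZ mulrA; apply: ler_wpM2r; first exact: vnorm_ge0.
  exact: absv_fact_le.
- by move=> n; rewrite mulr_ge0 ?vnorm_ge0// invr_ge0 exprn_ge0// ltW.
- by [].
- exists C => // n; rewrite expr_div_n mulrA mulrC ler_wpM2r//; last exact: cC.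
  by rewrite invr_ge0 exprn_ge0 ?(ltW q_gt0).
Qed.

(** * Existence and uniqueness *)

Lemma solution_exists x : E_ A x -> exists c, is_solution A x c.
Proof.
move=> [a a0 [dx ax]]; pose c n := n`!%:R^-1 *: iter n A x.
have dI n : dom A (iter n A x) by have [] := dx n.+1.
exists c; apply/solutionP; split.
- have qa0 : 0 < q * a by rewrite mulr_gt0.
  apply: lt_le_trans (conv_radius_ge qa0 (geobound_coef (c := c) _ ax)) => //.
  by rewrite lte_fin invr_gt0.
- by rewrite /c fact0 invr1 scale1r.
- move=> n; split; first exact: domZ.
  rewrite opfunZ// derivs1E scalerA; congr (_ *: _).
  by rewrite factS natrM invfM mulrA divff ?mul1r// natr_neq0.
Qed.

Lemma solution_E_a x c (a b : R) : is_solution A x c -> 0 < a -> a < b ->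
  geobound (vnorm \o c) a -> E_a A (b / q) x.
Proof.
move=> sol a0 ab ca; split=> [n|]; first by have [] := solution_iter sol n.
by apply: geobound_iter a0 ab ca => n; have [] := solution_iter sol n.
Qed.

Lemma solution_E x c : is_solution A x c -> E_ A x.
Proof.
move=> sol; have [cl _ _] := (solutionP x c).1 sol.
have [a [a0 _] ca] := lt_conv_radius (lexx 0) cl.
have aa : a < a + 1 by rewrite ltrDl.
exists ((a + 1) / q); first by rewrite divr_gt0// addr_gt0.
exact: solution_E_a sol a0 aa ca.
Qed.

Lemma solution_unique x c c' :
  is_solution A x c -> is_solution A x c' -> c = c'.
Proof.
move=> s s'; apply/funext => n.
by have [_ _ ->] := solution_iter s n; have [_ _ ->] := solution_iter s' n.
Qed.

(** * Type of the initial value and radius of the solution *)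

Lemma conv_radius_solution x c (a : R) : is_solution A x c -> 0 < a ->
  E_a A a x -> ((q * a)^-1%:E <= conv_radius c)%E.
Proof.
move=> sol a0 [_ xa]; apply: conv_radius_ge; first by rewrite mulr_gt0.
by apply: geobound_coef xa => n; have [] := solution_iter sol n.
Qed.

(** If l is the limit superior of the roots of the coefficient norms, the type is l / q and the
    radius 1 / l. For l = 0 the product would be 0 times infinity, so that case is stated
    separately. *)
Lemma type_conv_radius x c : is_solution A x c ->
  if type_of A x == 0%E then conv_radius c = +oo%E
  else (type_of A x * conv_radius c)%E = q^-1%:E.
Proof.
move=> sol; have [cl _ _] := (solutionP x c).1 sol.
have cn0 k : 0 <= vnorm (c k) by exact: vnorm_ge0.
have [l l0 Ll] : exists2 l, 0 <= l &
    limn_esup (fun n => (vnorm (c n) `^ n%:R^-1)%:E) = l%:E.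
  move: cl (limn_esup_root_ge0 (vnorm \o c)); rewrite /A_loc /conv_radius /=.
  by case: (limn_esup _) => [l _ l0| |]//; [exists l | rewrite invey ltxx].
have -> : type_of A x = (l / q)%:E.
  apply/le_anti/andP; split.
    apply/lee_addgt0Pr => e e0.
    (* Half of q e goes to exceeding the limit superior, half to the loss in [solution_E_a];
       dividing by q leaves l / q + e. *)
    have qe0 : 0 < q * e / 2 by rewrite divr_gt0// mulr_gt0.
    have [|a0 ca] := @limn_esup_root_lt _ (vnorm \o c) (l + q * e / 2) cn0.
      by rewrite Ll lte_fin ltrDl.
    have ae : l + q * e / 2 < l + q * e by lra.
    have := solution_E_a sol a0 ae ca.
    rewrite mulrDl (mulrC q) mulfK ?gt_eqF// => xE.
    apply: ereal_inf_lbound; exists (l / q + e) => //; split=> //.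
    by rewrite ltr_wpDl// divr_ge0// ltW.
  apply: le_ereal_inf_tmp => _ [a [a0 xa] <-].
  rewrite lee_fin ler_pdivrMr// mulrC.
  rewrite -lee_fin -Ll; apply: limn_esup_root_le; rewrite ?mulr_gt0//.
  by apply: geobound_coef xa.2 => n; have [] := solution_iter sol n.
rewrite /conv_radius Ll inver eqe mulf_eq0 invr_eq0 (gt_eqF q_gt0) orbF.
by case: eqP => // /eqP lN0; rewrite -EFinM mulrAC divff// mul1r.
Qed.

(** * Continuous dependence on the initial value *)

(** The n-th coefficient of the difference is A^n (x - x') / n!, of norm at most (q a)^n times the
    a-norm of x - x'; the geometric series is then summed. *)
Lemma norm_solutionB (x x' : V) c c' (a : R) z : is_solution A x c ->
  is_solution A x' c' -> 0 < a -> E_a A a x -> E_a A a x' ->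
  absv z * (q * a) < 1 ->
  ((vnorm (pow_sum c z - pow_sum c' z))%:E <=
     norm_a A a (x - x')%R * ((1 - absv z * (q * a))^-1)%R%:E)%E.
Proof.
move=> s s' a0 [dx xa] [dx' xa'] za; have qa0 : 0 < q * a by rewrite mulr_gt0.
have cE n : c n = n`!%:R^-1 *: iter n A x by have [] := solution_iter s n.
have cE' n : c' n = n`!%:R^-1 *: iter n A x' by have [] := solution_iter s' n.
have dE n : c n - c' n = n`!%:R^-1 *: iter n A (x - x').
  by have [_ ->] := dom_iterB (dx n) (dx' n); rewrite scalerBr -cE -cE'.
have ge n := norm_a_ge A (x - x') n a0.
have rho0 : 0 < (1 - absv z * (q * a))^-1 by rewrite invr_gt0 subr_gt0.
(* The value +oo makes the bound trivial, and the term n = 0 rules out -oo. *)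
case: norm_a ge => [r| |] ge; last 2 first.
- by rewrite gt0_mulye ?lte_fin// leey.
- by have := ge 0%N; rewrite leeNy_eq.
rewrite -EFinM lee_fin.
rewrite -(pow_sumB absv0 qa0 (geobound_coef cE xa) (geobound_coef cE' xa') za).
apply: pow_sum_le => // [|n].
  apply: le_trans (_ : vnorm (iter 0 A (x - x')) / a ^+ 0 <= _).
    by rewrite divr_ge0 ?vnorm_ge0 ?exprn_ge0// ltW.
  by have := ge 0%N; rewrite lee_fin.
rewrite dE vnormZ absvV// exprMn mulrCA; apply: ler_pM.
- by rewrite invr_ge0 absv_ge0.
- exact: vnorm_ge0.
- by rewrite -[leRHS]invrK lef_pV2 ?posrE ?invr_gt0 ?exprn_gt0 ?absv_gt0
    ?absv_fact_ge.
- by have := ge n; rewrite lee_fin ler_pdivrMr ?exprn_gt0.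
Qed.

Lemma solution_cvg (x : V) (u : nat -> V) (c_ : nat -> nat -> V) c :
  cvg_E A u x -> (forall n, is_solution A (u n) (c_ n)) -> is_solution A x c ->
  cvg_A_loc c_ c.
Proof.
move=> [a [a0 [N _ uE] xE ux]] s_ s; have qa0 : 0 < q * a by rewrite mulr_gt0.
(* Convergence in E(A) controls only the indices from [N] on, while the radius bound must hold for
   all; the finitely many earlier solutions have positive radii, whose lower bounds are combined by
   a minimum. *)
have [d d0 hd] : exists2 d : R, 0 < d & forall n, (n < N)%N ->
    (d%:E <= conv_radius (c_ n))%E.
  elim: N {uE} => [|N [d d0 hd]]; first by exists 1.
  have [b b0 ub] := solution_E (s_ N).
  exists (Num.min d (q * b)^-1).
    by rewrite lt_min d0 invr_gt0 mulr_gt0.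
  move=> n; rewrite ltnS leq_eqVlt => /predU1P[->|nN].
    apply: le_trans (conv_radius_solution (s_ N) b0 ub).
    by rewrite lee_fin ge_min lexx orbT.
  by apply: le_trans (hd n nN); rewrite lee_fin ge_min lexx.
exists (Num.min d (q * a)^-1); split.
- by rewrite lt_min d0 invr_gt0.
- move=> n; have [nN|Nn] := ltnP n N.
    by apply: le_trans (hd n nN); rewrite lee_fin ge_min lexx.
  apply: le_trans (conv_radius_solution (s_ n) a0 (uE n Nn)).
  by rewrite lee_fin ge_min lexx orbT.
- apply: le_trans (conv_radius_solution s a0 xE).
  by rewrite lee_fin ge_min lexx orbT.
move=> e /andP[e0 ed]; set r := _ - e.
have r0 : 0 <= r by rewrite subr_ge0 ltW.
have r1 : r * (q * a) < 1.
  rewrite -ltr_pdivlMr// mul1r.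
  apply: lt_le_trans (_ : Num.min d (q * a)^-1 <= _).
    by rewrite ltrBlDr ltrDl.
  by rewrite ge_min lexx orbT.
apply: (@squeeze_cvge _ _ _ _ (fun=> 0%E) _
  (fun n => norm_a A a (u n - x)%R * ((1 - r * (q * a))^-1)%R%:E)%E).
- exists N => // n Nn /=; apply/andP; split.
    (* The disk contains 0, so the supremum is over a nonempty set and is nonnegative. *)
    apply: ereal_sup_ge; exists (vnorm (pow_sum (c_ n) 0 - pow_sum c 0))%:E.
      by exists 0 => //=; rewrite absv0.
    by rewrite lee_fin vnorm_ge0.
  apply: ge_ereal_sup => _ [z /= zr <-].
  have zr' : absv z * (q * a) <= r * (q * a) by rewrite ler_wpM2r// ltW.
  apply: le_trans (norm_solutionB (s_ n) s a0 (uE n Nn) xE _) _.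
    exact: le_lt_trans r1.
  apply: lee_wpmul2l.
    apply: le_trans (norm_a_ge A (u n - x) 0 a0).
    by rewrite lee_fin divr_ge0 ?vnorm_ge0 ?exprn_ge0// ltW.
  rewrite lee_fin lef_pV2 ?posrE ?subr_gt0//; last exact: le_lt_trans r1.
  by rewrite lerD2l lerN2.
- exact: cvg_cst.
- by rewrite -(mul0e (1 - r * (q * a))^-1%:E); exact: cvgeZr.
Qed.

End PadicCauchy.

Theorem theorem1 (R : realType) (p : nat) (p_prime : prime p)
    (Omega : completeValuedFieldType R) (Omega_p : is_Omega_p p Omega)
    (B : banachType Omega) (A : linOp B) (A_closed : closed_op A) (y0 : B) :
  [/\ (exists y, is_solution A y0 y) <-> E_ A y0,
      (forall y, is_solution A y0 y ->
         if type_of A y0 == 0%E then conv_radius y = +oo%E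
         else (type_of A y0 * conv_radius y)%E
              = (p%:R `^ (- (p.-1)%:R^-1))%:E),
      (forall y y', is_solution A y0 y -> is_solution A y0 y' -> y = y') &
      (forall (yn0 : nat -> B) (yn : nat -> nat -> B) (y : nat -> B),
         E_ A y0 -> (forall n, E_ A (yn0 n)) -> cvg_E A yn0 y0 ->
         (forall n, is_solution A (yn0 n) (yn n)) -> is_solution A y0 y ->
         cvg_A_loc yn y)].
Proof.
(* [powRN] rewrites the constant p^(-1/(p-1)) as the inverse of q = p^(1/(p-1)). *)
have [e absv_e] := padic_embedding Omega_p; rewrite powRN.
split.
- split=> [[y]|]; first exact: (solution_E p_prime absv_e A_closed).
  exact: (solution_exists p_prime absv_e A_closed).
- exact: (type_conv_radius p_prime absv_e A_closed).
- exact: (solution_unique p_prime absv_e A_closed).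
- by move=> u c_ c _ _; exact: (solution_cvg p_prime absv_e A_closed).
Qed.
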